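(* Let $r\ge 1$, let $G=\sum_{i=1}^{r+1}u_i\otimes A_i$ be an $(r+1)$-Kronecker-Sum, and let $G'=\sum_{i=1}^{r}u'_i\otimes A'_i$ be the random $r$-Kronecker-Sum constructed by the algorithm OK (described in the context) from the input $u_1,\dots,u_{r+1}$, $A_1,\dots,A_{r+1}$. Then $G'$ unbiasedly approximates $G$, i.e. $\mathrm{E}[G']=G$. Moreover, for any random $r$-Kronecker-Sum $Y$ of the same format as $G'$ which satisfies $\mathrm{E}[Y]=G$, it holds that $\mathrm{Var}[Y]\ge \mathrm{Var}[G']$.
   Context: All matrices are real; $\|\cdot\|$ is the Frobenius norm and $\langle X_1,X_2\rangle=\mathrm{Tr}(X_1^TX_2)$ the corresponding inner product; $\otimes$ is the Kronecker product. For a random matrix $X'$, $\mathrm{Var}[X']=\mathrm{E}[\|X'-\mathrm{E}[X']\|^2]$. Kronecker-Sum: a matrix $G\in\mathbb{R}^{m_0\times n_0}$ is given as an $r$-Kronecker-Sum of format $(a,b,c,d)$ if we are given $u_1,\dots,u_r\in\mathbb{R}^{a\times b}$ and $A_1,\dots,A_r\in\mathbb{R}^{c\times d}$ with $ac=m_0$, $bd=n_0$ and $G=\sum_{i=1}^r u_i\otimes A_i$. A random $r$-Kronecker-Sum of format $(a,b,c,d)$ is one whose factors $u_i,A_i$ are random. The $r$-Kronecker-Sum $G'$ has the same format as $G$. Algorithm OK. Input: $u_1,\dots,u_{r+1}\in\mathbb{R}^{a\times b}$, $A_1,\dots,A_{r+1}\in\mathbb{R}^{c\times d}$. 1. Let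 $v_1,\dots,v_{r+1}$ be an orthonormal basis of $\mathrm{span}\{u_1,\dots,u_{r+1}\}$ and $B_1,\dots,B_{r+1}$ an orthonormal basis of $\mathrm{span}\{A_1,\dots,A_{r+1}\}$ (if a span has dimension smaller than $r+1$, the list is filled up with zeros). 2. For $1\le i,j\le r+1$ set $L_{i,j}=\langle v_i,u_j\rangle$, $R_{i,j}=\langle B_i,A_j\rangle$, and set $C=LR^T\in\mathbb{R}^{(r+1)\times(r+1)}$. 3. Compute random matrices $(L',R')=Opt(C)$, $L',R'\in\mathbb{R}^{(r+1)\times r}$ (see below). 4. For $1\le j\le r$ output $u'_j=\sum_{i=1}^{r+1}L'_{i,j}v_i$ and $A'_j=\sum_{i=1}^{r+1}R'_{i,j}B_i$. Subroutine $Opt(C)$. Input: $C\in\mathbb{R}^{(r+1)\times(r+1)}$. 1. Compute a singular value decomposition $C=UDV^T$ with $U,V$ orthogonal and $D=\mathrm{diag}(d_1,\dots,d_{r+1})$, $d_1\ge\dots\ge d_{r+1}\ge 0$. 2. Let $m=\min\{i:(r-i+1)d_i\le\sum_{j=i}^{r+1}d_j\}$, $s_1=\sum_{i=m}^{r+1}d_i$, $k=r-m+1$. 3. Let $z_0=\big(\sqrt{1-d_mk/s_1},\dots,\sqrt{1-d_{r+1}k/s_1}\big)^T\in\mathbb{R}^{(k+1)\times 1}$, and choose $z_1,\dots,z_k$ such that $z_0,z_1,\dots,z_k$ is an orthonormal basis of $\mathbb{R}^{(k+1)\times 1}$. 4. Let $s$ be a vector of $k+1$ independent uniformly random signs in $\{\pm1\}$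 and let $Z=\sqrt{s_1/k}\,(s\odot z_1,\dots,s\odot z_k)\in\mathbb{R}^{(k+1)\times k}$ be the matrix with these columns, where $\odot$ is the entrywise product. (If $s_1=0$, put $Z=0$.) 5. Let $M=\mathrm{diag}(\sqrt{d_1},\dots,\sqrt{d_{m-1}},Z)\in\mathbb{R}^{(r+1)\times r}$ (block-diagonal) and return $L'=UM$, $R'=VM$. *)

(* Defs.v *)
From HB Require Import structures.
From mathcomp Require Import all_boot all_order all_algebra.
From mathcomp Require Import all_classical all_reals all_analysis.
From mathcomp.real_closed Require Export mxtens.

Set Implicit Arguments.
Unset Strict Implicit.
Unset Printing Implicit Defensive.

Import Order.TTheory GRing.Theory Num.Theory.

Local Open Scope classical_set_scope.
Local Open Scope ring_scope.

Section Frobenius.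
Variable R : realType.

Definition frob_dot m n (X Y : 'M[R]_(m, n)) : R := \tr (X^T *m Y).

Definition frob_norm m n (X : 'M[R]_(m, n)) : R := Num.sqrt (frob_dot X X).

Definition orthonormal_basis m n (W : {vspace 'M[R]_(m, n)})
    (e : seq 'M[R]_(m, n)) : Prop :=
  basis_of W e /\
  forall i j : nat, (i < size e)%N -> (j < size e)%N ->
    frob_dot e`_i e`_j = (i == j)%:R.

(* The default value 0 of [e`_i] beyond [size e] pads the basis [e] with zeros;
   [size e <= N] holds because [e] is a basis of the span of [N] matrices. *)
Definition padded_orthonormal_basis m n N (x v : 'I_N -> 'M[R]_(m, n)) : Prop :=
  exists2 e, orthonormal_basis <<codom x>>%VS e & forall i, v i = e`_i.

(* [tensmx], i.e. [*t], is the Kronecker product. *)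
Definition kron_sum a b c e N (u : 'I_N -> 'M[R]_(a, b))
    (A : 'I_N -> 'M[R]_(c, e)) : 'M[R]_(a * c, b * e) :=
  \sum_(i < N) u i *t A i.

Definition orthogonal_mx n (U : 'M[R]_n) : Prop :=
  U^T *m U = 1%:M /\ U *m U^T = 1%:M.

Definition is_svd n (C U : 'M[R]_n) (d : 'rV[R]_n) (V : 'M[R]_n) : Prop :=
  [/\ orthogonal_mx U, orthogonal_mx V,
      forall i, 0 <= d 0 i,
      forall i j : 'I_n, (i <= j)%N -> d 0 j <= d 0 i
    & C = U *m diag_mx d *m V^T].

End Frobenius.

Section RandomMatrices.
Context (R : realType) (dT : measure_display) (T : measurableType dT)
        (P : probability T R).

Definition random_mx m n (X : T -> 'M[R]_(m, n)) : Prop :=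
  forall i j, measurable_fun setT (fun w => X w i j).

Definition mx_integrable m n (X : T -> 'M[R]_(m, n)) : Prop :=
  forall i j, P.-integrable setT (EFin \o (fun w => X w i j)).

Definition mx_expectation m n (X : T -> 'M[R]_(m, n)) : 'M[R]_(m, n) :=
  \matrix_(i, j) fine ('E_P[fun w => X w i j])%E.

(* Extended-real valued, as [X] need not be square integrable. *)
Definition mx_variance m n (X : T -> 'M[R]_(m, n)) : \bar R :=
  ('E_P[fun w => (frob_norm (X w - mx_expectation X) ^+ 2)%R])%E.

Definition mutually_independent (I : finType) (s : I -> {RV P >-> R}) : Prop :=
  forall (J : {set I}) (E : I -> set R), (forall i, measurable (E i)) ->
    P (\bigcap_(i in [set i | i \in J]) s i @^-1` E i) =
    (\prod_(i in J) fine (P (s i @^-1` E i)))%:E.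

Definition uniform_sign (X : {RV P >-> R}) : Prop :=
  [/\ forall w, X w = 1 \/ X w = -1,
      P [set w | X w = 1] = (2^-1)%:E
    & P [set w | X w = -1] = (2^-1)%:E].

Definition independent_uniform_signs n (s : 'I_n -> {RV P >-> R}) : Prop :=
  (forall i, uniform_sign (s i)) /\ mutually_independent s.

End RandomMatrices.

Section Opt.
Context (R : realType) (r : nat).

(* Singular values are indexed from 0 here: the (0-based) index [opt_m d] is
   m - 1 for the m of the usual 1-based description, whence the factor
   [r - i] in place of r - i + 1. The set minimised over always contains
   [ord_max] when [d] is nonnegative. *)
Definition opt_m (d : 'rV[R]_r.+1) : 'I_r.+1 :=
  [arg min_(i < ord_max |
      ((r - i)%:R * d 0 i <= \sum_(j < r.+1 | (i <= j)%N) d 0 j)%R) i]%N.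

Definition opt_k (d : 'rV[R]_r.+1) : nat := (r - opt_m d)%N.

Lemma opt_rowE (d : 'rV[R]_r.+1) : (opt_m d + (opt_k d).+1 = r.+1)%N.
Proof. by rewrite addnS /opt_k subnKC // -ltnS. Qed.

Lemma opt_colE (d : 'rV[R]_r.+1) : (opt_m d + opt_k d = r)%N.
Proof. by rewrite /opt_k subnKC // -ltnS. Qed.

Definition opt_split (d : 'rV[R]_r.+1) : 'rV[R]_(opt_m d + (opt_k d).+1) :=
  castmx (erefl, esym (opt_rowE d)) d.

Definition opt_head (d : 'rV[R]_r.+1) : 'rV[R]_(opt_m d) :=
  lsubmx (opt_split d).

Definition opt_tail (d : 'rV[R]_r.+1) : 'rV[R]_(opt_k d).+1 :=
  rsubmx (opt_split d).

Definition opt_s1 (d : 'rV[R]_r.+1) : R := \sum_j opt_tail d 0 j.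

Definition opt_z0 (d : 'rV[R]_r.+1) : 'cV[R]_(opt_k d).+1 :=
  \col_i Num.sqrt (1 - opt_tail d 0 i * (opt_k d)%:R / opt_s1 d).

(* When [opt_s1 d = 0] the vector z_0 is not defined and the z_j are not used. *)
Definition opt_completion (d : 'rV[R]_r.+1)
    (z : 'I_(opt_k d) -> 'cV[R]_(opt_k d).+1) : Prop :=
  opt_s1 d != 0 ->
  orthonormal_basis fullv (opt_z0 d :: [seq z j | j <- enum 'I_(opt_k d)]).

Definition opt_Z (d : 'rV[R]_r.+1) (z : 'I_(opt_k d) -> 'cV[R]_(opt_k d).+1)
    (s : 'I_(opt_k d).+1 -> R) : 'M[R]_((opt_k d).+1, opt_k d) :=
  if opt_s1 d == 0 then 0
  else Num.sqrt (opt_s1 d / (opt_k d)%:R) *: \matrix_(i, j) (s i * z j i 0).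

Definition opt_M (d : 'rV[R]_r.+1) (z : 'I_(opt_k d) -> 'cV[R]_(opt_k d).+1)
    (s : 'I_(opt_k d).+1 -> R) : 'M[R]_(r.+1, r) :=
  castmx (opt_rowE d, opt_colE d)
    (block_mx (diag_mx (map_mx Num.sqrt (opt_head d))) 0 0 (opt_Z z s)).

End Opt.

Section OK.
Context (R : realType) (r a b c e : nat).

Definition OK_C (u v : 'I_r.+1 -> 'M[R]_(a, b)) (A B : 'I_r.+1 -> 'M[R]_(c, e)) :
    'M[R]_r.+1 :=
  let L := \matrix_(i, j) frob_dot (v i) (u j) in
  let S := \matrix_(i, j) frob_dot (B i) (A j) in
  L *m S^T.

Definition OK_factor m n (v : 'I_r.+1 -> 'M[R]_(m, n)) (L' : 'M[R]_(r.+1, r))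
    (j : 'I_r) : 'M[R]_(m, n) :=
  \sum_(i < r.+1) L' i j *: v i.

(* Output G' of one run of the algorithm, for the chosen bases [v], [B],
   singular value decomposition [U], [d], [V], completion [z] and signs [s]. *)
Definition OK_output (v : 'I_r.+1 -> 'M[R]_(a, b)) (B : 'I_r.+1 -> 'M[R]_(c, e))
    (U : 'M[R]_r.+1) (d : 'rV[R]_r.+1) (V : 'M[R]_r.+1)
    (z : 'I_(opt_k d) -> 'cV[R]_(opt_k d).+1) (s : 'I_(opt_k d).+1 -> R) :
    'M[R]_(a * c, b * e) :=
  kron_sum (OK_factor v (U *m opt_M z s)) (OK_factor B (V *m opt_M z s)).

End OK.

(* Main.v *)
Require Import Defs.
From HB Require Import structures.
From mathcomp Require Import all_boot all_order all_algebra.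
From mathcomp Require Import all_classical all_reals all_analysis.
From mathcomp Require Import measurable_realfun ring lra.

Set Implicit Arguments.
Unset Strict Implicit.
Unset Printing Implicit Defensive.

Import Order.TTheory GRing.Theory Num.Theory.

Local Open Scope classical_set_scope.
Local Open Scope ring_scope.

(* Let [t = s_1 / k]. The signs make every run of the algorithm miss the
   diagonal matrix of singular values [D] by the off-diagonal entries
   [- t z_0i z_0j s_i s_j] only; these have mean zero and a norm that does not
   depend on the signs, so [Var G' <= t^2 - |S - D|^2], where [S] is [D] with
   its last [k + 1] entries replaced by [t]. Conversely all entries of [S] are
   at least [t], so every matrix of rank at most [r] is at distance at least [t]
   from [U S V^T]. Passing from [Y] to its matrix of coordinates in the basis
   [v_i (x) B_l] gives such a matrix [W] of mean [C = U D V^T], and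
   [|W - C|^2 = |W - U S V^T|^2 + 2 <W - C, U S V^T - C> - |S - D|^2], whose
   middle term has mean zero. *)

(** * The Frobenius inner product, and the distance from singular to diagonal matrices *)

Section FrobeniusTheory.
Variable R : realType.

Lemma frob_dotE m n (X Y : 'M[R]_(m, n)) :
  frob_dot X Y = \sum_i \sum_j X i j * Y i j.
Proof.
rewrite /frob_dot /mxtrace exchange_big; apply: eq_bigr => j _.
by rewrite !mxE; apply: eq_bigr => i _; rewrite mxE.
Qed.

Lemma frob_dotC m n (X Y : 'M[R]_(m, n)) : frob_dot X Y = frob_dot Y X.
Proof. by rewrite /frob_dot -mxtrace_tr trmx_mul trmxK. Qed.

Lemma frob_dotDl m n (X1 X2 Y : 'M[R]_(m, n)) :
  frob_dot (X1 + X2) Y = frob_dot X1 Y + frob_dot X2 Y.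
Proof. by rewrite /frob_dot linearD mulmxDl mxtraceD. Qed.

Lemma frob_dotDr m n (Y X1 X2 : 'M[R]_(m, n)) :
  frob_dot Y (X1 + X2) = frob_dot Y X1 + frob_dot Y X2.
Proof. by rewrite /frob_dot mulmxDr mxtraceD. Qed.

Lemma frob_dotNl m n (X Y : 'M[R]_(m, n)) : frob_dot (- X) Y = - frob_dot X Y.
Proof. by rewrite /frob_dot linearN mulNmx raddfN. Qed.

Lemma frob_dotNr m n (Y X : 'M[R]_(m, n)) : frob_dot Y (- X) = - frob_dot Y X.
Proof. by rewrite /frob_dot mulmxN raddfN. Qed.

Lemma frob_dotZl m n (x : R) (X Y : 'M[R]_(m, n)) :
  frob_dot (x *: X) Y = x * frob_dot X Y.
Proof. by rewrite /frob_dot linearZ -scalemxAl mxtraceZ. Qed.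

Lemma frob_dotZr m n (x : R) (Y X : 'M[R]_(m, n)) :
  frob_dot Y (x *: X) = x * frob_dot Y X.
Proof. by rewrite /frob_dot -scalemxAr mxtraceZ. Qed.

Lemma frob_dot0r m n (X : 'M[R]_(m, n)) : frob_dot X 0 = 0.
Proof. by rewrite /frob_dot mulmx0 raddf0. Qed.

Lemma frob_dot_sumr m n I (s : seq I) (X : 'M[R]_(m, n)) (F : I -> 'M[R]_(m, n)) :
  frob_dot X (\sum_(i <- s) F i) = \sum_(i <- s) frob_dot X (F i).
Proof. by rewrite /frob_dot mulmx_sumr raddf_sum. Qed.

Lemma frob_dot_suml m n I (s : seq I) (X : 'M[R]_(m, n)) (F : I -> 'M[R]_(m, n)) :
  frob_dot (\sum_(i <- s) F i) X = \sum_(i <- s) frob_dot (F i) X.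
Proof.
by rewrite frob_dotC frob_dot_sumr; apply: eq_bigr => i _; rewrite frob_dotC.
Qed.

Lemma frob_dot_ge0 m n (X : 'M[R]_(m, n)) : 0 <= frob_dot X X.
Proof.
by rewrite frob_dotE; apply: sumr_ge0 => i _; apply: sumr_ge0 => j _; exact: sqr_ge0.
Qed.

Lemma frob_norm_sqr m n (X : 'M[R]_(m, n)) : frob_norm X ^+ 2 = frob_dot X X.
Proof. by rewrite sqr_sqrtr ?frob_dot_ge0. Qed.

Lemma frob_dotDD m n (X Y : 'M[R]_(m, n)) :
  frob_dot (X + Y) (X + Y) = frob_dot X X + 2 * frob_dot X Y + frob_dot Y Y.
Proof. rewrite frob_dotDl !frob_dotDr (frob_dotC Y X); ring. Qed.

Lemma frob_dotBB m n (X Y : 'M[R]_(m, n)) :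
  frob_dot (X - Y) (X - Y) = frob_dot X X - 2 * frob_dot X Y + frob_dot Y Y.
Proof. by rewrite frob_dotDD frob_dotNr frob_dotNl frob_dotNr opprK mulrN. Qed.

Lemma frob_dot_tens a b c e (X1 Y1 : 'M[R]_(a, b)) (X2 Y2 : 'M[R]_(c, e)) :
  frob_dot (X1 *t X2) (Y1 *t Y2) = frob_dot X1 Y1 * frob_dot X2 Y2.
Proof.
rewrite /frob_dot trmx_tens tensmx_mul /mxtrace big_distrlr/= pair_big/=.
rewrite (reindex (@mxtens_index b e))/=; last first.
  exact/onW_bij/(Bijective (@mxtens_indexK b e) (@mxtens_unindexK b e)).
by apply: eq_bigr => -[i j] _; rewrite tensmxE.
Qed.

(** The squared norm of [frob_dot Y Y *: X - frob_dot X Y *: Y] is nonnegative; dividing it by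
    [frob_dot Y Y] leaves the claim. *)
Lemma frob_cauchy_schwarz m n (X Y : 'M[R]_(m, n)) :
  frob_dot X Y ^+ 2 <= frob_dot X X * frob_dot Y Y.
Proof.
have [Y0|Y0] := eqVneq (frob_dot Y Y) 0.
  suff -> : Y = 0 by rewrite !frob_dot0r expr0n mulr0.
  apply/matrixP => i j; rewrite mxE; apply/eqP; rewrite -sqrf_eq0.
  move: Y0; rewrite frob_dotE pair_big/= => /eqP.
  rewrite psumr_eq0 => [/allP/(_ (i, j))/=|ij _]; last exact: sqr_ge0.
  by rewrite mem_index_enum; exact.
have Ygt0 : 0 < frob_dot Y Y by rewrite lt_neqAle eq_sym Y0 frob_dot_ge0.
have := frob_dot_ge0 (frob_dot Y Y *: X - frob_dot X Y *: Y).
rewrite frob_dotBB !frob_dotZl !frob_dotZr => H.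
rewrite -subr_ge0 -(pmulr_rge0 _ Ygt0); apply: le_trans H _.
by rewrite le_eqVlt; apply/orP; left; apply/eqP; ring.
Qed.

(** Each entry of the product is the inner product of a row of [X] and a column of [Y];
    Cauchy-Schwarz bounds its square, and the bounds add up to the product of the squared norms. *)
Lemma frob_mulmx_le m n p (X : 'M[R]_(m, n)) (Y : 'M[R]_(n, p)) :
  frob_dot (X *m Y) (X *m Y) <= frob_dot X X * frob_dot Y Y.
Proof.
have row_dot q k (Z : 'M[R]_(q, k)) :
    frob_dot Z Z = \sum_i frob_dot (row i Z) (row i Z).
  rewrite frob_dotE; apply: eq_bigr => i _; rewrite frob_dotE big_ord1.
  by apply: eq_bigr => j _; rewrite mxE.
have col_dot q k (Z : 'M[R]_(q, k)) :
    frob_dot Z Z = \sum_j frob_dot (col j Z)^T (col j Z)^T.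
  rewrite frob_dotE exchange_big; apply: eq_bigr => j _.
  by rewrite frob_dotE big_ord1; apply: eq_bigr => i _; rewrite !mxE.
rewrite (row_dot _ _ X) (col_dot _ _ Y) big_distrlr/= frob_dotE.
apply: ler_sum => i _; apply: ler_sum => j _.
have -> : (X *m Y) i j = frob_dot (row i X) (col j Y)^T.
  by rewrite mxE frob_dotE big_ord1; apply: eq_bigr => k _; rewrite !mxE.
exact: frob_cauchy_schwarz.
Qed.

Lemma frob_dot_orthogonal n (U V X Y : 'M[R]_n) :
  orthogonal_mx U -> orthogonal_mx V ->
  frob_dot (U *m X *m V^T) (U *m Y *m V^T) = frob_dot X Y.
Proof.
move=> [UU _] [VV _]; rewrite /frob_dot !trmx_mul trmxK.
rewrite !mulmxA -(mulmxA (V *m X^T)) UU mulmx1.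
by rewrite mxtrace_mulC -!mulmxA (mulmxA V^T) VV mul1mx.
Qed.

Lemma frob_dot_castmx m n m' n' (eq_mn : (m = m') * (n = n'))
    (X Y : 'M[R]_(m, n)) :
  frob_dot (castmx eq_mn X) (castmx eq_mn Y) = frob_dot X Y.
Proof. by case: eq_mn => em en; case: m' / em; case: n' / en; rewrite !castmx_id. Qed.

Lemma frob_dot_drblock m1 m2 n1 n2 (X Y : 'M[R]_(m2, n2)) :
  frob_dot (block_mx (0 : 'M[R]_(m1, n1)) 0 0 X) (block_mx 0 0 0 Y) =
  frob_dot X Y.
Proof.
rewrite /frob_dot tr_block_mx mulmx_block !trmx0 !mul0mx !mulmx0 !add0r.
by rewrite mxtrace_block mxtrace0 add0r.
Qed.

Lemma frob_dot_diag n (x y : 'rV[R]_n) :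
  frob_dot (diag_mx x) (diag_mx y) = \sum_i x 0 i * y 0 i.
Proof.
rewrite frob_dotE; apply: eq_bigr => i _; rewrite (bigD1 i)//= !mxE eqxx.
by rewrite big1 ?addr0// => j ji; rewrite !mxE eq_sym (negbTE ji) mul0r.
Qed.

(* The row kernel of a singular matrix contains some [x != 0], and then
   [x *m (W - diag_mx y) = - x *m diag_mx y] has norm at least [t] times the
   norm of [x]. *)
Lemma singular_dist_diag n k (X : 'M[R]_(n, k)) (Y : 'M[R]_(k, n))
    (y : 'rV[R]_n) (t : R) :
  (k < n)%N -> 0 <= t -> (forall i, t <= y 0 i) ->
  t ^+ 2 <= frob_dot (X *m Y - diag_mx y) (X *m Y - diag_mx y).
Proof.
move=> kn t0 ty; set W := X *m Y.
have /rowV0Pn[x /sub_kermxP xW x0] : kermx W != 0.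
  rewrite kermx_eq0 -row_leq_rank -ltnNge.
  by rewrite (leq_ltn_trans _ kn)// (leq_trans (mulmx_max_rank _ _)).
have xx0 : 0 < frob_dot x x.
  have [i xi0] : exists i, x 0 i != 0 by apply/rV0Pn.
  rewrite frob_dotE big_ord1 (bigD1 i)//= ltr_pwDl//.
    by rewrite lt_neqAle eq_sym mulf_neq0// -expr2 sqr_ge0.
  by apply: sumr_ge0 => j _; exact: sqr_ge0.
rewrite -(ler_pM2l xx0); apply: le_trans (frob_mulmx_le _ _).
rewrite mulmxBr xW sub0r frob_dotNl frob_dotNr opprK !frob_dotE !big_ord1.
rewrite mulr_suml; apply: ler_sum => j _.
rewrite mul_mx_diag mxE [leRHS]mulrACA -!expr2 ler_wpM2l ?sqr_ge0//.
by rewrite lerXn2r ?nnegrE ?(le_trans t0).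
Qed.

(** * Orthonormal families padded with zeros *)

Section OrthonormalFamily.
Context (m n : nat) (I : finType) (f : I -> 'M[R]_(m, n)) (p : pred I).
Hypothesis fP : forall i j, frob_dot (f i) (f j) = ((i == j) && p i)%:R.

(** The predicate [p] marks the nonzero members of the family. A coefficient on a zero member is
    lost, hence an inequality instead of Parseval's identity. *)
Lemma frob_comb_le (x : I -> R) :
  frob_dot (\sum_i x i *: f i) (\sum_i x i *: f i) <= \sum_i x i ^+ 2.
Proof.
rewrite frob_dot_suml; apply: ler_sum => i _.
rewrite frob_dotZl frob_dot_sumr (bigD1 i)//= frob_dotZr fP eqxx/=.
rewrite big1 ?addr0 => [|j ji]; last by rewrite frob_dotZr fP eq_sym (negbTE ji) mulr0.
by case: (p i); rewrite ?mulr1 // !mulr0 sqr_ge0.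
Qed.

(** The squared norm of [X] minus its projection is nonnegative, and [frob_comb_le] bounds the norm
    of the projection. *)
Lemma frob_bessel (X : 'M[R]_(m, n)) :
  \sum_i frob_dot X (f i) ^+ 2 <= frob_dot X X.
Proof.
have := frob_dot_ge0 (X - \sum_i frob_dot X (f i) *: f i).
rewrite frob_dotBB frob_dot_sumr.
under eq_bigr do rewrite frob_dotZr -expr2.
move=> H; have := frob_comb_le (fun i => frob_dot X (f i)); lra.
Qed.

End OrthonormalFamily.

Lemma padded_orthonormal_dot m n N (x v : 'I_N -> 'M[R]_(m, n)) :
  padded_orthonormal_basis x v ->
  exists p : pred 'I_N, forall i j, frob_dot (v i) (v j) = ((i == j) && p i)%:R.
Proof.
move=> [s [_ s_on] vE]; exists (fun i => (i < size s)%N) => i j; rewrite !vE.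
have [si|si] := ltnP i (size s); last first.
  by rewrite andbF nth_default// frob_dotC frob_dot0r.
have [sj|sj] := ltnP j (size s); first by rewrite s_on// andbT.
rewrite [X in frob_dot _ X]nth_default// frob_dot0r.
by case: eqP => // ij; rewrite ij ltnNge sj in si.
Qed.

Lemma padded_orthonormal_expand m n N (x v : 'I_N -> 'M[R]_(m, n)) j :
  padded_orthonormal_basis x v -> x j = \sum_i frob_dot (v i) (x j) *: v i.
Proof.
move=> [s [s_basis s_on] vE].
have sN : (size s <= N)%N.
  rewrite -(size_basis (s_basis : basis_of _ (in_tuple s))).
  by rewrite (leq_trans (dim_span _))// size_codom card_ord.
have xE : x j = \sum_i coord (in_tuple s) i (x j) *: s`_i.
  apply: (coord_basis (X := in_tuple s) s_basis).
  by rewrite memv_span// codom_f.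
have xj_dot i (si : (i < size s)%N) :
    frob_dot s`_i (x j) = coord (in_tuple s) (Ordinal si) (x j).
  rewrite {1}xE frob_dot_sumr (bigD1 (Ordinal si))//= frob_dotZr s_on// eqxx mulr1.
  rewrite big1 ?addr0// => l; rewrite -val_eqE/= => li.
  by rewrite frob_dotZr s_on// eq_sym (negbTE li) mulr0.
(* Indices from [size s] on carry the padding zeros; what remains is the expansion in the basis
   itself. *)
rewrite [RHS](bigID (fun i : 'I_N => (i < size s)%N))/= addrC big1 ?add0r.
  under [RHS]eq_bigr do rewrite vE.
  rewrite -(big_ord_widen N (fun i => frob_dot s`_i (x j) *: s`_i) sN) [LHS]xE.
  by apply: eq_bigr => -[i si] _; rewrite xj_dot.
by move=> i; rewrite -leqNgt => si; rewrite vE nth_default// scaler0.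
Qed.

(** * Coordinates in the products [v i *t B l] *)

Section KroneckerCoordinates.
Context (N a b c e : nat) (v : 'I_N -> 'M[R]_(a, b)) (B : 'I_N -> 'M[R]_(c, e)).

(** The synthesis map of the family [v i *t B l], with adjoint [kron_coef]. For padded orthonormal
    families both are contractions, which is how norms pass between Kronecker-Sums and square
    matrices of size [N]. *)
Definition kron_comb (X : 'M[R]_N) : 'M[R]_(a * c, b * e) :=
  \sum_i \sum_l X i l *: (v i *t B l).

Definition kron_coef (Y : 'M[R]_(a * c, b * e)) : 'M[R]_N :=
  \matrix_(i, l) frob_dot Y (v i *t B l).

Lemma kron_combD X1 X2 : kron_comb (X1 + X2) = kron_comb X1 + kron_comb X2.
Proof.
rewrite -big_split; apply: eq_bigr => i _; rewrite -big_split.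
by apply: eq_bigr => l _; rewrite mxE scalerDl.
Qed.

Lemma kron_coefB Y1 Y2 : kron_coef (Y1 - Y2) = kron_coef Y1 - kron_coef Y2.
Proof. by apply/matrixP => i l; rewrite !mxE frob_dotDl frob_dotNl. Qed.

Lemma kron_coef_adjoint Y X :
  frob_dot (kron_coef Y) X = frob_dot Y (kron_comb X).
Proof.
rewrite frob_dotE frob_dot_sumr; apply: eq_bigr => i _.
rewrite frob_dot_sumr; apply: eq_bigr => l _.
by rewrite mxE frob_dotZr mulrC.
Qed.

(** The coordinate matrix factors through dimension [k], which bounds its rank. For the input of the
    algorithm this product is [OK_C]. *)
Lemma kron_coef_kron_sum k (x : 'I_k -> 'M[R]_(a, b)) (X : 'I_k -> 'M[R]_(c, e)) :
  kron_coef (kron_sum x X) =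
  (\matrix_(i, j) frob_dot (v i) (x j)) *m (\matrix_(i, j) frob_dot (B i) (X j))^T.
Proof.
apply/matrixP => i l; rewrite !mxE frob_dot_suml; apply: eq_bigr => j _.
by rewrite frob_dot_tens !mxE (frob_dotC (x j)) (frob_dotC (X j)).
Qed.

Variables (p q : pred 'I_N).
Hypothesis vP : forall i j, frob_dot (v i) (v j) = ((i == j) && p i)%:R.
Hypothesis BP : forall i j, frob_dot (B i) (B j) = ((i == j) && q i)%:R.

Let tensP (i j : 'I_N * 'I_N) :
  frob_dot (v i.1 *t B i.2) (v j.1 *t B j.2) =
  ((i == j) && (p i.1 && q i.2))%:R.
Proof.
rewrite frob_dot_tens vP BP -natrM mulnb; congr (_%:R).
by case: i j => [i1 i2] [j1 j2]/=; rewrite xpair_eqE andbACA.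
Qed.

Lemma kron_comb_le X : frob_dot (kron_comb X) (kron_comb X) <= frob_dot X X.
Proof.
rewrite /kron_comb !pair_big/= [leRHS]frob_dotE pair_big/=.
exact: (frob_comb_le tensP (fun i => X i.1 i.2)).
Qed.

Lemma kron_coef_le Y : frob_dot (kron_coef Y) (kron_coef Y) <= frob_dot Y Y.
Proof.
apply: le_trans (frob_bessel tensP Y); rewrite frob_dotE pair_big/=.
by apply: ler_sum => i _; rewrite mxE.
Qed.

End KroneckerCoordinates.

(** Bilinearity of the Kronecker product; it turns the output factors of the algorithm into a single
    coefficient matrix. *)
Lemma kron_comb_kron_sum N k a b c e (v : 'I_N -> 'M[R]_(a, b))
    (B : 'I_N -> 'M[R]_(c, e)) (L S : 'M[R]_(N, k)) :
  kron_comb v B (L *m S^T) =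
  kron_sum (fun j => \sum_i L i j *: v i) (fun j => \sum_i S i j *: B i).
Proof.
have tensE (x : 'M[R]_(a, b)) (y : 'M[R]_(c, e)) i j :
    (x *t y) i j = x (mxtens_unindex i).1 (mxtens_unindex j).1 *
                   y (mxtens_unindex i).2 (mxtens_unindex j).2.
  by rewrite mxE.
apply/matrixP => i j; rewrite /kron_comb /kron_sum !summxE.
under [RHS]eq_bigr => l _.
  rewrite tensE !summxE big_distrlr/=.
  over.
rewrite exchange_big/=; apply: eq_bigr => i1 _.
rewrite summxE exchange_big/=; apply: eq_bigr => i2 _.
rewrite mxE tensE mxE mulr_suml; apply: eq_bigr => l _.
by rewrite !mxE; ring.
Qed.

End FrobeniusTheory.

(** * Means of real random variables *)

Section Mean.
Context (R : realType) (dT : measure_display) (T : measurableType dT)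
        (P : probability T R).

(** Integrability is bundled with the value of the integral, so that means combine linearly without
    the truncation of infinite values by [fine]. *)
Definition has_mean (f : T -> R) (m : R) : Prop :=
  P.-integrable setT (EFin \o f) /\ (\int[P]_w (f w)%:E = m%:E)%E.

Lemma has_mean_cst m : has_mean (fun=> m) m.
Proof.
split; first exact: finite_measure_integrable_cst.
by rewrite integral_cst//= probability_setT mule1.
Qed.

Lemma has_meanD f g mf mg : has_mean f mf -> has_mean g mg ->
  has_mean (fun w => f w + g w) (mf + mg).
Proof.
move=> [fi fE] [gi gE]; split.
  by apply: eq_integrable (integrableD measurableT fi gi) => // w _; rewrite /= EFinD.
under eq_integral do rewrite EFinD.
by rewrite (integralD_EFin measurableT fi gi)/= fE gE.
Qed.

Lemma has_meanZ x f m : has_mean f m -> has_mean (fun w => x * f w) (x * m).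
Proof.
move=> [fi fE]; split.
  by apply: eq_integrable (integrableZl measurableT x fi) => // w _; rewrite /= EFinM.
under eq_integral do rewrite EFinM.
by rewrite (integralZl measurableT fi)/= fE.
Qed.

Lemma has_mean_sum (I : Type) (s : seq I) (f : I -> T -> R) (m : I -> R) :
  (forall i, has_mean (f i) (m i)) ->
  has_mean (fun w => \sum_(i <- s) f i w) (\sum_(i <- s) m i).
Proof.
move=> fm; elim: s => [|i s IHs].
  rewrite big_nil; under [X in has_mean X]funext do rewrite big_nil.
  exact: has_mean_cst.
rewrite big_cons; under [X in has_mean X]funext do rewrite big_cons.
exact: has_meanD.
Qed.

Lemma has_mean_indic (A : set T) : measurable A ->
  has_mean (fun w => \1_A w) (fine (P A)).
Proof.
move=> mA; split; first exact: integrable_indic.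
by rewrite integral_indic// setIT fineK ?fin_num_measure.
Qed.

(** The integral of [g] may be infinite, as may the variance of a competitor; the bound is then
    trivial. Otherwise [g] is integrable and monotonicity applies. *)
Lemma has_mean_le_integral (f g : T -> R) m : has_mean f m -> measurable_fun setT g ->
  (forall w, 0 <= g w) -> (forall w, f w <= g w) ->
  (m%:E <= \int[P]_w (g w)%:E)%E.
Proof.
move=> [fi <-] mg g0 fg.
have [gfin|] := ltP (\int[P]_w (g w)%:E)%E +oo%E; last first.
  by rewrite leye_eq => /eqP ->; rewrite leey.
apply: le_integral => //; last by move=> w _; rewrite lee_fin.
apply/integrableP; split; first exact/measurable_EFinP.
by under eq_integral do rewrite /= ger0_norm//.
Qed.

Lemma ge0_integral_le_cst (f : T -> R) m : (forall w, 0 <= f w) -> measurable_fun setT f ->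
  (forall w, f w <= m) -> (\int[P]_w (f w)%:E <= m%:E)%E.
Proof.
move=> f0 mf fm; have [_ <-] := has_mean_cst m.
apply: ge0_le_integral => //=.
- by move=> w _; rewrite lee_fin.
- exact/measurable_EFinP.
- by move=> w _; rewrite lee_fin.
Qed.


(** * Entrywise means of random matrices, and products of independent signs *)

Definition mx_has_mean m n (X : T -> 'M[R]_(m, n)) (M : 'M[R]_(m, n)) : Prop :=
  forall i j, has_mean (fun w => X w i j) (M i j).

Lemma mx_has_meanP m n (X : T -> 'M[R]_(m, n)) M :
  mx_has_mean X M <-> mx_integrable P X /\ mx_expectation P X = M.
Proof.
split=> [XM|[Xi <-] i j].
  split=> [i j|]; first by have [] := XM i j.
  by apply/matrixP => i j; rewrite mxE unlock (XM i j).2.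
split; first exact: Xi.
rewrite mxE unlock fineK//; exact: integrable_fin_num (Xi i j).
Qed.

Lemma mx_has_mean_cst m n (M : 'M[R]_(m, n)) : mx_has_mean (fun=> M) M.
Proof. by move=> i j; exact: has_mean_cst. Qed.

Lemma mx_has_meanD m n (X Y : T -> 'M[R]_(m, n)) M N :
  mx_has_mean X M -> mx_has_mean Y N -> mx_has_mean (fun w => X w + Y w) (M + N).
Proof.
move=> XM YN i j; rewrite mxE; under [X in has_mean X]funext do rewrite mxE.
exact: has_meanD.
Qed.

Lemma has_mean_frob_dot m n (X : T -> 'M[R]_(m, n)) M K :
  mx_has_mean X M -> has_mean (fun w => frob_dot (X w) K) (frob_dot M K).
Proof.
move=> XM; rewrite frob_dotE.
under [X in has_mean X]funext do rewrite frob_dotE.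
apply: has_mean_sum => i; apply: has_mean_sum => j.
rewrite mulrC; under [X in has_mean X]funext do rewrite mulrC.
exact: has_meanZ.
Qed.

Lemma mx_has_mean_mulmxl m n p (L : 'M[R]_(p, m)) (X : T -> 'M[R]_(m, n)) M :
  mx_has_mean X M -> mx_has_mean (fun w => L *m X w) (L *m M).
Proof.
move=> XM i j; rewrite mxE; under [X in has_mean X]funext do rewrite mxE.
by apply: has_mean_sum => k; exact: has_meanZ.
Qed.

Lemma mx_has_mean_tr m n (X : T -> 'M[R]_(m, n)) M :
  mx_has_mean X M -> mx_has_mean (fun w => (X w)^T) M^T.
Proof.
by move=> XM i j; rewrite mxE; under [X in has_mean X]funext do rewrite mxE.
Qed.

Lemma mx_has_mean_kron_comb N a b c e (v : 'I_N -> 'M[R]_(a, b))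
    (B : 'I_N -> 'M[R]_(c, e)) X M :
  mx_has_mean X M ->
  mx_has_mean (fun w => kron_comb v B (X w)) (kron_comb v B M).
Proof.
move=> XM i j; rewrite summxE; under [X in has_mean X]funext do rewrite summxE.
apply: has_mean_sum => i1.
rewrite summxE; under [X in has_mean X]funext do rewrite summxE.
apply: has_mean_sum => i2.
rewrite mxE mulrC.
under [X in has_mean X]funext do rewrite mxE mulrC.
exact: has_meanZ.
Qed.

Lemma mx_has_mean_drblock m1 m2 n1 n2 m n (eq_mn : ((m1 + m2)%N = m) * ((n1 + n2)%N = n))
    (X : T -> 'M[R]_(m2, n2)) :
  mx_has_mean X 0 ->
  mx_has_mean (fun w => castmx eq_mn (block_mx (0 : 'M[R]_(m1, n1)) 0 0 (X w))) 0.
Proof.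
case: eq_mn => em en; case: m / em; case: n / en => X0 i j.
under [X in has_mean X]funext do rewrite castmx_id.
rewrite mxE -(fintype.splitK i) -(fintype.splitK j).
case: (fintype.split i) => i'; case: (fintype.split j) => j' /=.
- under [X in has_mean X]funext do rewrite block_mxEul mxE; exact: has_mean_cst.
- under [X in has_mean X]funext do rewrite block_mxEur mxE; exact: has_mean_cst.
- under [X in has_mean X]funext do rewrite block_mxEdl mxE; exact: has_mean_cst.
- under [X in has_mean X]funext do rewrite block_mxEdr.
  by have := X0 i' j'; rewrite mxE.
Qed.

Lemma measurable_frob_norm_sqr m n (X : T -> 'M[R]_(m, n)) M N :
  mx_has_mean X M ->
  measurable_fun setT (fun w => frob_norm (X w - N) ^+ 2).
Proof.
move=> XM; under [X in measurable_fun _ X]funext do rewrite frob_norm_sqr frob_dotE.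
apply: measurable_sum => i; apply: measurable_sum => j.
suff mX : measurable_fun setT (fun w => (X w - N) i j) by exact: measurable_funM.
under [X in measurable_fun _ X]funext do rewrite mxE.
apply: measurable_funD; last exact: measurable_cst.
by have [/integrableP[/measurable_EFinP]] := XM i j.
Qed.

(** Each sign is affine in the indicator of the event that it equals 1. The product thus expands
    into indicators of two events and of their intersection, which has probability 1/4 by
    independence. *)
Lemma independent_signs_mean n (s : 'I_n -> {RV P >-> R}) i j :
  independent_uniform_signs s -> i != j ->
  has_mean (fun w => s i w * s j w) 0.
Proof.
move=> [s_sign s_indep] ij; set A := fun l => s l @^-1` [set 1].
have mA l : measurable (A l).
  by rewrite /A -[_ @^-1` _]setTI; apply: measurable_funPT.
have sE l w : s l w = 2 * \1_(A l) w - 1.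
  rewrite indicE; have [/(_ w)[|] sw _ _] := s_sign l.
    by rewrite sw mem_set// mulr1; ring.
  rewrite sw memNset; first by rewrite mulr0 sub0r.
  by rewrite /A/= sw => s1; lra.
have PA l : fine (P (A l)) = 2^-1 by have [_ -> _] := s_sign l.
have PAij : fine (P (A i `&` A j)) = 4^-1.
  have := s_indep [set i; j]%SET (fun=> [set 1]) (fun=> measurable_set1 1).
  rewrite big_setU1 ?inE//= big_set1 !PA => PE.
  have -> : A i `&` A j = \bigcap_(l in [set l | l \in [set i; j]%SET]) A l.
    apply/seteqP; split => [w [Ai Aj] l /=|w Aw].
      by rewrite !inE => /orP[] /eqP ->.
    by split; apply: Aw; rewrite /= !inE eqxx ?orbT.
  by rewrite PE/= -invfM -natrM.
(* The summands are the means of the four terms of the expanded product. *)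
have -> : 0 = 4 * 4^-1 + (- 2 * 2^-1 + (- 2 * 2^-1 + 1)) :> R by lra.
have -> : (fun w => s i w * s j w) =
    (fun w => 4 * \1_(A i `&` A j) w +
              (- 2 * \1_(A i) w + (- 2 * \1_(A j) w + 1))).
  by apply/funext => w; rewrite !sE indicI/=; ring.
have A_mean l : has_mean (fun w => \1_(A l) w) 2^-1.
  by rewrite -(PA l); exact: has_mean_indic.
apply: has_meanD; last apply: has_meanD; last apply: has_meanD.
- by apply: has_meanZ; rewrite -PAij; apply/has_mean_indic/measurableI.
- exact: has_meanZ.
- exact: has_meanZ.
- exact: has_mean_cst.
Qed.

End Mean.

(** * Diagonal and Gram matrices split into a head and a tail block *)

Section CastBlock.
Context (R : realType) (p q n : nat) (E : (p + q)%N = n).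
Implicit Types d x : 'rV[R]_n.

Lemma sum_cast_rsubmx d :
  \sum_(j < n | (p <= j)%N) d 0 j =
  \sum_j rsubmx (castmx (erefl, esym E) d) 0 j.
Proof.
case: n / E d => d; rewrite castmx_id big_mkcond big_split_ord/= big1 ?add0r.
  by apply: eq_bigr => j _; rewrite mxE leq_addr.
by move=> i _; rewrite leqNgt ltn_ord.
Qed.

Lemma cast_diag_mxB d x :
  lsubmx (castmx (erefl, esym E) x) = lsubmx (castmx (erefl, esym E) d) ->
  diag_mx x - diag_mx d =
  castmx (E, E) (block_mx 0 0 0
    (diag_mx (rsubmx (castmx (erefl, esym E) x)
              - rsubmx (castmx (erefl, esym E) d)))).
Proof.
case: n / E d x => d x; rewrite !castmx_id => xd.
rewrite -{1}(hsubmxK x) -{1}(hsubmxK d) xd !diag_mx_row opp_block_mx add_block_mx.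
by rewrite !subrr linearB.
Qed.

(** The square roots in the head reproduce the head of [d] exactly, so the Gram matrix deviates from
    [diag_mx d] in the tail block only. *)
Lemma cast_block_gram q' n' (E' : (p + q')%N = n') d (Z : 'M[R]_(q, q')) :
  (forall i, 0 <= d 0 i) ->
  let M := castmx (E, E') (block_mx
    (diag_mx (map_mx Num.sqrt (lsubmx (castmx (erefl, esym E) d)))) 0 0 Z) in
  M *m M^T - diag_mx d =
  castmx (E, E) (block_mx 0 0 0
    (Z *m Z^T - diag_mx (rsubmx (castmx (erefl, esym E) d)))).
Proof.
case: n / E d => d d0; case: n' / E'; rewrite !castmx_id /=.
rewrite tr_block_mx mulmx_block !trmx0 !mul0mx !mulmx0 !add0r !addr0 tr_diag_mx.
rewrite -[diag_mx d](_ : block_mx (diag_mx (lsubmx d)) 0 0 (diag_mx (rsubmx d)) = _).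
  2: by rewrite -diag_mx_row hsubmxK.
rewrite opp_block_mx add_block_mx !oppr0 !addr0.
rewrite [X in block_mx X](_ : _ = 0) //; apply/matrixP => i j.
rewrite mul_diag_mx !mxE; case: (i == j); last by rewrite !mulr0n mulr0 subr0.
by rewrite !mulr1n -expr2 sqr_sqrtr ?subrr// d0.
Qed.

End CastBlock.

(** * The truncation level, and the noise that the signs cause *)

Section OptTheory.
Context (R : realType) (r : nat) (d : 'rV[R]_r.+1).
Hypothesis hr : (1 <= r)%N.
Hypothesis d_ge0 : forall i, 0 <= d 0 i.
Hypothesis d_dec : forall i j : 'I_r.+1, (i <= j)%N -> d 0 j <= d 0 i.

Let k := opt_k d.

Definition opt_level : R := opt_s1 d / k%:R.

Let opt_cond (i : 'I_r.+1) :=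
  (r - i)%:R * d 0 i <= \sum_(j < r.+1 | (i <= j)%N) d 0 j.

Let opt_mP : opt_cond (opt_m d) /\ forall i, opt_cond i -> (opt_m d <= i)%N.
Proof.
rewrite /opt_m; case: arg_minnP => [|i ci imin]; last by split.
(* The default [ord_max] satisfies the condition, its factor [r - r] being zero. *)
by rewrite /= subnn mul0r; apply: sumr_ge0.
Qed.

Let opt_s1E : opt_s1 d = \sum_(j < r.+1 | (opt_m d <= j)%N) d 0 j.
Proof. by rewrite (sum_cast_rsubmx (opt_rowE d)). Qed.

(** The index [r.-1] satisfies the condition: as [r] is positive its factor is 1, and the sum on the
    right contains its own entry. *)
Lemma opt_k_gt0 : (0 < opt_k d)%N.
Proof.
have r1 : (r.-1 < r.+1)%N by rewrite ltnS leq_pred.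
rewrite subn_gt0; have /(opt_mP.2) /= : opt_cond (Ordinal r1).
  rewrite /opt_cond.
  have -> : (r - Ordinal r1 = 1)%N by rewrite /= -{1}(prednK hr) subSnn.
  rewrite mul1r (bigD1 (Ordinal r1))//= lerDl.
  exact: sumr_ge0.
by move=> /leq_ltn_trans; apply; rewrite prednK.
Qed.

Let k_gt0 : 0 < k%:R :> R. Proof. by rewrite ltr0n opt_k_gt0. Qed.

Lemma opt_tail_ge0 i : 0 <= opt_tail d 0 i.
Proof. by rewrite mxE castmxE /= cast_ord_id. Qed.

Lemma opt_level_ge0 : 0 <= opt_level.
Proof. by rewrite divr_ge0 ?ler0n//; apply: sumr_ge0 => i _; exact: opt_tail_ge0. Qed.

(** The first entry of the tail is its largest, and for it the bound is the inequality defining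
    [opt_m], divided by [k]. *)
Lemma opt_tail_le_level i : opt_tail d 0 i <= opt_level.
Proof.
rewrite ler_pdivlMr// mulrC opt_s1E; apply: le_trans opt_mP.1.
by rewrite ler_wpM2l// mxE castmxE/= ?cast_ord_id; apply: d_dec; rewrite /= leq_addr.
Qed.

(* By minimality of [opt_m d], the index just before it violates the defining
   inequality, i.e. the last head entry exceeds [opt_level]. *)
Lemma opt_level_le_head i : opt_level <= opt_head d 0 i.
Proof.
have m_gt0 : (0 < opt_m d)%N by apply: leq_ltn_trans (ltn_ord i).
have m1r : ((opt_m d).-1 < r.+1)%N by rewrite (leq_ltn_trans (leq_pred _)).
set l := Ordinal m1r.
have li : d 0 l <= opt_head d 0 i.
  rewrite mxE castmxE/= ?cast_ord_id; apply: d_dec => /=.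
  by rewrite -ltnS prednK.
apply: le_trans li; rewrite ler_pdivrMr//.
have : ~ opt_cond l.
  by move=> /opt_mP.2; rewrite leqNgt /= prednK ?leqnn.
move=> /negP; rewrite -ltNge (bigD1 l)//=.
(* The factor at [l] is [k.+1]: one copy of [d 0 l] cancels the first summand on the right, leaving
   [opt_s1 d < k%:R * d 0 l]. *)
have -> : (r - (opt_m d).-1)%N = k.+1.
  by rewrite /k /opt_k -{2}(prednK m_gt0) subnS prednK// subn_gt0 prednK// -ltnS.
rewrite -natr1 mulrDl mul1r [ltRHS]addrC ltrD2l opt_s1E => /ltW; rewrite mulrC.
apply: le_trans; rewrite le_eqVlt; apply/orP; left; apply/eqP; apply: eq_bigl => j.
by rewrite -val_eqE/= andbC -[in LHS](prednK m_gt0) ltn_neqAle eq_sym.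
Qed.

(* The target at which the distance to the matrices of rank at most [r]
   is attained: the head of [d] followed by [k + 1] copies of [opt_level]. *)
Definition opt_flat : 'rV[R]_r.+1 :=
  castmx (erefl, opt_rowE d) (row_mx (opt_head d) (const_mx opt_level)).

Lemma opt_level_le_flat i : opt_level <= opt_flat 0 i.
Proof.
rewrite castmxE -(fintype.splitK (cast_ord _ i)).
case: (fintype.split _) => j /=; first by rewrite row_mxEl ord1 opt_level_le_head.
by rewrite row_mxEr mxE.
Qed.

Lemma opt_flatB_sqr :
  frob_dot (diag_mx opt_flat - diag_mx d) (diag_mx opt_flat - diag_mx d) =
  \sum_i (opt_level - opt_tail d 0 i) ^+ 2.
Proof.
rewrite (cast_diag_mxB (E := opt_rowE d)); last first.
  by rewrite castmx_comp castmx_id row_mxKl.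
rewrite frob_dot_castmx frob_dot_drblock frob_dot_diag; apply: eq_bigr => i _.
by rewrite castmx_comp castmx_id row_mxKr !mxE expr2.
Qed.

Lemma opt_level_z0 i : opt_level * opt_z0 d i 0 ^+ 2 = opt_level - opt_tail d 0 i.
Proof.
(* If [opt_s1 d] vanishes, so do the level and every entry of the nonnegative tail, whatever value
   [opt_z0] takes after a division by zero. *)
have [s0|s0] := eqVneq (opt_s1 d) 0.
  have /eqP := s0; rewrite psumr_eq0 => [/allP|j _]; last exact: opt_tail_ge0.
  move=> /(_ i); rewrite mem_index_enum => /(_ isT) /eqP ->.
  by rewrite /opt_level s0 mul0r mul0r subr0.
have s_gt0 : 0 < opt_s1 d.
  rewrite lt_neqAle eq_sym s0 /=; apply: sumr_ge0 => j _; exact: opt_tail_ge0.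
have k0 : (opt_k d)%:R != 0 :> R by rewrite gt_eqF.
rewrite mxE sqr_sqrtr; first by rewrite /opt_level /k; field; rewrite ?s0 ?k0.
rewrite subr_ge0 ler_pdivrMr// mul1r -ler_pdivlMr//; exact: opt_tail_le_level.
Qed.

(** With t the level, the sum is (k + 1) t - s_1, and s_1 = k t. *)
Lemma sum_opt_levelB : \sum_i (opt_level - opt_tail d 0 i) = opt_level.
Proof.
rewrite sumrB sumr_const card_ord -/(opt_s1 d) -mulr_natr -natr1.
have k0 : (opt_k d)%:R != 0 :> R by rewrite gt_eqF.
by rewrite /opt_level /k; field; rewrite ?k0.
Qed.

(** The off-diagonal part of - t w w^T, where t is the level and w the entrywise product of the
    signs and z_0. *)
Definition opt_noise (s : 'I_k.+1 -> R) : 'M[R]_k.+1 :=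
  \matrix_(i, j) if i == j then 0
                 else - (opt_level * opt_z0 d i 0 * opt_z0 d j 0) * (s i * s j).

(** By [opt_level_z0] the squared entries off the diagonal are [x i * x j], whatever the signs. They
    add up to the square of the sum of the [x i], which is the squared level, minus the squares
    [x i ^+ 2]. *)
Lemma opt_noise_sqr s : (forall i, s i = 1 \/ s i = -1) ->
  frob_dot (opt_noise s) (opt_noise s) =
  opt_level ^+ 2 - \sum_i (opt_level - opt_tail d 0 i) ^+ 2.
Proof.
move=> s1; have ss i : s i ^+ 2 = 1 by case: (s1 i) => ->; ring.
pose x i := opt_level - opt_tail d 0 i; rewrite frob_dotE.
have -> : opt_level ^+ 2 = \sum_i x i * \sum_j x j.
  by rewrite -mulr_suml sum_opt_levelB expr2.
rewrite -sumrB; apply: eq_bigr => i _; rewrite mulr_sumr.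
rewrite (bigD1 i)//= [in RHS](bigD1 i)//= mxE eqxx mulr0 add0r expr2 [RHS]addrC addKr.
apply: eq_bigr => j ji; rewrite mxE eq_sym (negbTE ji) /x -!opt_level_z0.
transitivity (opt_level * opt_z0 d i 0 ^+ 2 * (opt_level * opt_z0 d j 0 ^+ 2) *
              (s i ^+ 2 * s j ^+ 2)); first by ring.
by rewrite !ss !mulr1.
Qed.

(** A square matrix with orthonormal columns has orthonormal rows; splitting off the column
    [opt_z0 d] leaves the sum over the [z j]. *)
Lemma opt_completion_gram z : opt_completion z -> opt_s1 d != 0 ->
  forall i l : 'I_k.+1,
  \sum_j z j i 0 * z j l 0 = (i == l)%:R - opt_z0 d i 0 * opt_z0 d l 0.
Proof.
move=> /[apply] -[_]; move: (opt_z0 d) => z0.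
set e := _ :: _ => e_on i l.
have se : size e = k.+1 by rewrite /= size_map size_enum_ord.
pose X : 'M[R]_k.+1 := \matrix_(i, j) e`_j i 0.
have : X^T *m X = 1%:M.
  apply/matrixP => j1 j2; rewrite [RHS]mxE -[RHS]e_on ?se ?ltn_ord//.
  by rewrite frob_dotE mxE; apply: eq_bigr => m _; rewrite big_ord1 !mxE.
move=> /mulmx1C /matrixP /(_ i l); rewrite [RHS]mxE => <-.
rewrite mxE big_ord_recl !mxE/= [RHS]addrC addKr; apply: eq_bigr => j _.
by rewrite !mxE/= (nth_map j) ?size_enum_ord ?add0n// nth_ord_enum.
Qed.

(** On the diagonal the signs square to 1 and [opt_level_z0] gives exactly the tail. Off the
    diagonal the identity matrix vanishes, and only the z_0 term of [opt_completion_gram]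
    survives. *)
Lemma opt_Z_gram z s : opt_completion z -> (forall i, s i = 1 \/ s i = -1) ->
  opt_Z z s *m (opt_Z z s)^T - diag_mx (opt_tail d) = opt_noise s.
Proof.
move=> zP s1; have ss i : s i * s i = 1 by case: (s1 i) => ->; ring.
apply/matrixP => i l.
have subE (X : 'M[R]_k.+1) (x : 'rV[R]_k.+1) :
    (X - diag_mx x) i l = X i l - x 0 i *+ (i == l) by rewrite !mxE.
rewrite subE [RHS]mxE /opt_Z; case: (eqVneq (opt_s1 d) 0) => [s0|s0].
  have t0 : opt_level = 0 by rewrite /opt_level s0 mul0r.
  have := opt_level_z0 i; rewrite t0 mul0r sub0r => /eqP.
  rewrite eq_sym oppr_eq0 => /eqP tail0.
  by rewrite mul0mx mxE tail0 mul0rn !mul0r oppr0 mul0r if_same addr0.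
rewrite linearZ -scalemxAl -scalemxAr scalerA -expr2 sqr_sqrtr ?opt_level_ge0//.
rewrite -/opt_level mxE [X in _ * X]mxE.
under eq_bigr do rewrite !mxE mulrACA.
rewrite -mulr_sumr opt_completion_gram//.
case: eqP => [<-|_]; last by rewrite !mulr0n; ring.
rewrite ss !mulr1n mul1r mulrBr mulr1 -expr2 opt_level_z0; ring.
Qed.

Lemma opt_M_gram z s : opt_completion z -> (forall i, s i = 1 \/ s i = -1) ->
  opt_M z s *m (opt_M z s)^T =
  diag_mx d + castmx (opt_rowE d, opt_rowE d) (block_mx 0 0 0 (opt_noise s)).
Proof.
move=> zP s1; rewrite -(opt_Z_gram zP s1) -(cast_block_gram (opt_rowE d) (opt_colE d))//.
by rewrite addrC subrK.
Qed.

End OptTheory.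

(** * The algorithm in coordinates, and the bound for every competitor *)

Lemma OK_C_kron_comb (R : realType) (r a b c e : nat)
    (u v : 'I_r.+1 -> 'M[R]_(a, b)) (A B : 'I_r.+1 -> 'M[R]_(c, e)) :
  padded_orthonormal_basis u v -> padded_orthonormal_basis A B ->
  kron_comb v B (OK_C u v A B) = kron_sum u A.
Proof.
move=> hv hB; rewrite kron_comb_kron_sum; apply: eq_bigr => j _; congr (_ *t _).
  rewrite [RHS](padded_orthonormal_expand _ hv).
  by apply: eq_bigr => i _; rewrite mxE.
rewrite [RHS](padded_orthonormal_expand _ hB).
by apply: eq_bigr => i _; rewrite mxE.
Qed.

Lemma OK_output_kron_comb (R : realType) (r a b c e : nat)
    (v : 'I_r.+1 -> 'M[R]_(a, b)) (B : 'I_r.+1 -> 'M[R]_(c, e))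
    (U V : 'M[R]_r.+1) (d : 'rV[R]_r.+1) z s :
  OK_output v B U V z s =
  kron_comb v B (U *m (opt_M (d := d) z s *m (opt_M z s)^T) *m V^T).
Proof.
by rewrite /OK_output -kron_comb_kron_sum trmx_mul !mulmxA.
Qed.

(* [t ^+ 2] is the squared distance from [U *m diag_mx y *m V^T] to the
   matrices of rank less than [N], and expanding the square around the mean
   turns it into the constant and an affine function of [Y] of mean zero. *)
Lemma kron_sum_mean_lower_bound (R : realType) (N k a b c e : nat)
    (v : 'I_N -> 'M[R]_(a, b)) (B : 'I_N -> 'M[R]_(c, e)) (p q : pred 'I_N)
    (U V : 'M[R]_N) (d y : 'rV[R]_N) (t : R)
    (G : 'M[R]_(a * c, b * e))
    (x : 'I_k -> 'M[R]_(a, b)) (X : 'I_k -> 'M[R]_(c, e)) :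
  (forall i j, frob_dot (v i) (v j) = ((i == j) && p i)%:R) ->
  (forall i j, frob_dot (B i) (B j) = ((i == j) && q i)%:R) ->
  orthogonal_mx U -> orthogonal_mx V ->
  kron_coef v B G = U *m diag_mx d *m V^T ->
  (k < N)%N -> 0 <= t -> (forall i, t <= y 0 i) ->
  t ^+ 2 - frob_dot (diag_mx y - diag_mx d) (diag_mx y - diag_mx d)
    + 2 * frob_dot (kron_sum x X - G)
        (kron_comb v B (U *m (diag_mx y - diag_mx d) *m V^T))
  <= frob_dot (kron_sum x X - G) (kron_sum x X - G).
Proof.
move=> vP BP Uo Vo CG kN t0 ty; set Y := kron_sum x X.
rewrite -kron_coef_adjoint; apply: le_trans (kron_coef_le vP BP _).
set W := kron_coef v B (Y - G); set K := diag_mx y - diag_mx d.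
set H := U *m K *m V^T.
have WH : t ^+ 2 <= frob_dot (W - H) (W - H).
  have [[_ UU] [_ VV]] := (Uo, Vo).
  rewrite /W kron_coefB CG kron_coef_kron_sum.
  set L := \matrix_(i, j) _; set S := \matrix_(i, j) _.
  (* Once [U] and [V] are pulled out, the product inside still passes through dimension [k], so
     [singular_dist_diag] applies. *)
  have -> : L *m S^T - U *m diag_mx d *m V^T - H =
      U *m ((U^T *m L) *m (S^T *m V) - diag_mx y) *m V^T.
    rewrite /H /K !mulmxBr !mulmxBl !mulmxA UU mul1mx -!mulmxA VV mulmx1 !mulmxA.
    by rewrite opprB addrA subrK.
  by rewrite frob_dot_orthogonal//; exact: singular_dist_diag.
have HH : frob_dot H H = frob_dot K K by rewrite frob_dot_orthogonal.
rewrite frob_dotBB HH in WH; lra.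
Qed.

Theorem theorem1 (R : realType) (r a b c e : nat) (hr : (1 <= r)%N)
    (u : 'I_r.+1 -> 'M[R]_(a, b)) (A : 'I_r.+1 -> 'M[R]_(c, e))
    (v : 'I_r.+1 -> 'M[R]_(a, b)) (B : 'I_r.+1 -> 'M[R]_(c, e))
    (hv : padded_orthonormal_basis u v) (hB : padded_orthonormal_basis A B)
    (U : 'M[R]_r.+1) (d : 'rV[R]_r.+1) (V : 'M[R]_r.+1)
    (hsvd : is_svd (OK_C u v A B) U d V)
    (z : 'I_(opt_k d) -> 'cV[R]_(opt_k d).+1) (hz : opt_completion z)
    (dT : measure_display) (T : measurableType dT) (P : probability T R)
    (s : 'I_(opt_k d).+1 -> {RV P >-> R})
    (hs : independent_uniform_signs s) :
  let G := kron_sum u A in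
  let G' := fun w : T => OK_output v B U V z (fun i => s i w) in
  [/\ mx_integrable P G', mx_expectation P G' = G &
      forall (dT' : measure_display) (T' : measurableType dT')
        (Q : probability T' R)
        (x : 'I_r -> T' -> 'M[R]_(a, b)) (X : 'I_r -> T' -> 'M[R]_(c, e)),
      (forall i, random_mx (x i)) -> (forall i, random_mx (X i)) ->
      let Y := fun w : T' => kron_sum (fun i => x i w) (fun i => X i w) in
      mx_integrable Q Y -> mx_expectation Q Y = G ->
      (mx_variance P G' <= mx_variance Q Y)%E].
Proof.
move=> G G'; have [Uo Vo d_ge0 d_dec CE] := hsvd.
have [p vP] := padded_orthonormal_dot hv.
have [q BP] := padded_orthonormal_dot hB.
have GE : kron_comb v B (U *m diag_mx d *m V^T) = G.
  by rewrite -CE OK_C_kron_comb.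
have s_sign w i : s i w = 1 \/ s i w = -1 by have [/(_ i)[]] := hs.
(* The only random part of [G'], in coordinates relative to [U] and [V]. *)
pose N w : 'M[R]_r.+1 := castmx (opt_rowE d, opt_rowE d)
  (block_mx 0 0 0 (opt_noise (fun i => s i w))).
have G'E w : G' w = G + kron_comb v B (U *m N w *m V^T).
  rewrite /G' OK_output_kron_comb opt_M_gram//.
  by rewrite mulmxDr mulmxDl kron_combD GE.
have N_mean : mx_has_mean P N 0.
  apply: mx_has_mean_drblock => i j; rewrite mxE.
  under [X in has_mean _ X]funext do rewrite mxE.
  have [_|ij] := eqVneq i j; first exact: has_mean_cst.
  have := has_meanZ (- (opt_level d * opt_z0 d i 0 * opt_z0 d j 0))
            (independent_signs_mean hs ij).
  by rewrite mulr0.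
have G'_mean : mx_has_mean P G' G.
  have -> : G' = fun w => G + kron_comb v B (U *m N w *m V^T) by apply/funext.
  have {2}-> : G = G + kron_comb v B (U *m 0 *m V^T).
    rewrite mulmx0 mul0mx /kron_comb big1 ?addr0// => i _.
    by rewrite big1// => l _; rewrite mxE scale0r.
  apply: mx_has_meanD; first exact: mx_has_mean_cst.
  apply: mx_has_mean_kron_comb.
  (* Right multiplication by [V^T] is left multiplication by [V] between two transpositions. *)
  have := mx_has_mean_tr (mx_has_mean_mulmxl V
            (mx_has_mean_tr (mx_has_mean_mulmxl U N_mean))).
  by rewrite trmx_mul trmxK; under [X in mx_has_mean _ X]funext do rewrite trmx_mul trmxK.
have [G'_int G'_exp] := (mx_has_meanP _ _ _).1 G'_mean.
split=> // dT' T' Q x X _ _ Y Y_int Y_exp.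
have Y_mean : mx_has_mean Q Y G by apply/mx_has_meanP.
(* [K] separates the two variances: it bounds the squared error of [G'] at every outcome, and it is
   the mean of the lower bound [f] for that of [Y]. *)
pose K := opt_level d ^+ 2 -
  \sum_i (opt_level d - opt_tail d 0 i) ^+ 2.
rewrite /mx_variance G'_exp Y_exp unlock; apply: (@le_trans _ _ K%:E).
  apply: ge0_integral_le_cst => [w||w]; first exact: sqr_ge0.
    exact: measurable_frob_norm_sqr G'_mean.
  rewrite frob_norm_sqr G'E addrAC subrr add0r.
  apply: le_trans (kron_comb_le vP BP _) _.
  by rewrite frob_dot_orthogonal// frob_dot_castmx frob_dot_drblock opt_noise_sqr.
pose H := U *m (diag_mx (opt_flat d) - diag_mx d) *m V^T.
pose f w := K + 2 * frob_dot (Y w - G) (kron_comb v B H).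
have f_mean : has_mean Q f K.
  have YG_mean := mx_has_meanD Y_mean (mx_has_mean_cst Q (- G)).
  have := has_meanD (has_mean_cst Q K)
    (has_meanZ 2 (has_mean_frob_dot (kron_comb v B H) YG_mean)).
  by rewrite subrr frob_dotC frob_dot0r mulr0 addr0.
apply: has_mean_le_integral f_mean _ _ _ => [|w|w].
- exact: measurable_frob_norm_sqr Y_mean.
- exact: sqr_ge0.
rewrite frob_norm_sqr /f /K -opt_flatB_sqr.
apply: kron_sum_mean_lower_bound vP BP Uo Vo _ _ _ _ => //.
(* The coordinates of [G] form [OK_C u v A B], which the singular value decomposition factors. *)
- by rewrite kron_coef_kron_sum.
- exact: opt_level_ge0.
- exact: opt_level_le_flat.
Qed.
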